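(* Let $k$ be a positive integer and let $A_1, \ldots, A_k$ be a partition of $\mathbb{N}$ into $k$ sets. Then for all prime numbers $p$ except at most $\lfloor \log_2 k \rfloor$ of them, at least one of the ratio sets $R(A_1), \ldots, R(A_k)$ is dense in $\mathbb{Q}_p$.
   Context: $\mathbb{N}$ denotes the set of positive integers. For $A \subseteq \mathbb{N}$, $R(A) := \{a/b : a, b \in A\}$, viewed as a subset of $\mathbb{Q}_p$ with the $p$-adic topology. $\lfloor x \rfloor$ is the greatest integer not exceeding $x$ and $\log_2$ is the base-$2$ logarithm. *)

(* Defs.v *)
From HB Require Import structures.
From mathcomp Require Import all_boot all_order all_algebra.
From mathcomp Require Import generic_quotient ring_quotient.
From mathcomp Require Import all_classical.
From mathcomp Require Import topology.

Set Implicit Arguments.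
Unset Strict Implicit.
Unset Printing Implicit Defensive.

Import Order.TTheory GRing.Theory Num.Theory.

Local Open Scope quotient_scope.
Local Open Scope classical_set_scope.
Local Open Scope ring_scope.

Section PadicNorm.
Variable p : nat.

Definition padic_val (x : rat) : int :=
  (logn p `|numq x|)%:Z - (logn p `|denq x|)%:Z.

Definition padic_norm (x : rat) : rat :=
  if x == 0 then 0 else p%:R ^ (- padic_val x).

Hypothesis p_pr : prime p.

Let p_gt0 : 0 < p%:R :> rat.
Proof. by rewrite ltr0n prime_gt0. Qed.

Let p_gt1 : 1 < p%:R :> rat.
Proof. by rewrite ltr1n prime_gt1. Qed.

Lemma padic_norm0 : padic_norm 0 = 0.
Proof. by rewrite /padic_norm eqxx. Qed.

Lemma padic_norm_eq0 x : (padic_norm x == 0) = (x == 0).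
Proof.
rewrite /padic_norm; case: ifP => [|_]; first by rewrite eqxx.
by apply/negbTE; rewrite expfz_neq0 // gt_eqF.
Qed.

Lemma padic_norm_ge0 x : 0 <= padic_norm x.
Proof. by rewrite /padic_norm; case: ifP => // _; rewrite exprz_ge0 // ltW. Qed.

Lemma padic_norm_gt0 x : (0 < padic_norm x) = (x != 0).
Proof. by rewrite lt_def padic_norm_ge0 padic_norm_eq0 andbT. Qed.

Lemma padic_val_frac (a b : int) : a != 0 -> b != 0 ->
  padic_val (a%:~R / b%:~R) = (logn p `|a|)%:Z - (logn p `|b|)%:Z.
Proof.
move=> a0 b0; set x := (_ / _ : rat).
have x0 : x != 0 by rewrite /x mulf_neq0 ?invr_eq0 ?intr_eq0.
have E : (a * denq x)%R = (numq x * b)%R.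
  apply: (@intr_inj rat); rewrite !rmorphM /= numqE.
  have bq0 : b%:~R != 0 :> rat by rewrite intr_eq0.
  by rewrite mulrAC {2}/x mulfVK.
have := congr1 (fun z : int => logn p `|z|%N) E.
rewrite !abszM !lognM ?absz_gt0 ?denq_neq0 ?numq_eq0 // => EE.
apply/eqP; rewrite /padic_val subr_eq addrAC eq_sym subr_eq.
by rewrite -!PoszD EE.
Qed.

Lemma padic_normM x y : padic_norm (x * y) = padic_norm x * padic_norm y.
Proof.
rewrite /padic_norm mulf_eq0.
have [->|x0] := eqVneq x 0; first by rewrite /= mul0r.
have [->|y0] := eqVneq y 0; first by rewrite orbT mulr0.
rewrite /= -expfzDr ?gt_eqF//-opprD; congr (_ ^ - _).
have -> : x * y = (numq x * numq y)%:~R / (denq x * denq y)%:~R.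
  by rewrite -{1}[x]divq_num_den -{1}[y]divq_num_den mulf_div !rmorphM.
rewrite padic_val_frac ?mulf_neq0 ?numq_eq0 ?denq_neq0 //.
rewrite !abszM !lognM ?absz_gt0 ?denq_neq0 ?numq_eq0 //.
by rewrite /padic_val !PoszD opprD addrACA.
Qed.

Lemma padic_norm1 : padic_norm 1 = 1.
Proof. by rewrite /padic_norm oner_eq0 /padic_val !logn1. Qed.

Lemma padic_normN x : padic_norm (- x) = padic_norm x.
Proof. by rewrite /padic_norm oppr_eq0 /padic_val numqN denqN abszN. Qed.

Lemma padic_normV (x : rat) : padic_norm x^-1 = (padic_norm x)^-1.
Proof.
have [->|x0] := eqVneq x 0; first by rewrite invr0 padic_norm0.
have n0 : padic_norm x != 0 by rewrite padic_norm_eq0.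
by apply: (mulfI n0); rewrite -padic_normM !mulfV // padic_norm1.
Qed.

Lemma padic_normB x y : padic_norm (x - y) = padic_norm (y - x).
Proof. by rewrite -padic_normN opprB. Qed.

Lemma padic_normD x y :
  padic_norm (x + y) <= Num.max (padic_norm x) (padic_norm y).
Proof.
have [->|x0] := eqVneq x 0; first by rewrite add0r le_max lexx orbT.
have [->|y0] := eqVneq y 0; first by rewrite addr0 le_max lexx.
have [->|xy0] := eqVneq (x + y) 0.
  by rewrite padic_norm0 le_max padic_norm_ge0.
pose d := (denq x * denq y)%R.
pose a := (numq x * denq y)%R.
pose b := (numq y * denq x)%R.
have d0 : d != 0 by rewrite mulf_neq0 ?denq_neq0.
have dq0 : d%:~R != 0 :> rat by rewrite intr_eq0.
have Ex : x = a%:~R / d%:~R.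
  apply: (mulIf dq0); rewrite divfK // /d /a !rmorphM /= numqE.
  by rewrite mulrA.
have Ey : y = b%:~R / d%:~R.
  apply: (mulIf dq0); rewrite divfK // /d /b !rmorphM /= numqE.
  by rewrite mulrA mulrAC.
have Exy : x + y = (a + b)%:~R / d%:~R by rewrite Ex Ey -mulrDl -rmorphD.
have a0 : a != 0 by rewrite mulf_neq0 ?denq_neq0 ?numq_eq0.
have b0 : b != 0 by rewrite mulf_neq0 ?denq_neq0 ?numq_eq0.
have ab0 : a + b != 0.
  by apply: contraNneq xy0 => ab0; rewrite Exy ab0 mul0r.
rewrite /padic_norm (negbTE x0) (negbTE y0) (negbTE xy0) Exy Ex Ey.
rewrite !padic_val_frac // le_max !ler_eXz2l // !opprB.
rewrite !lerD2l !lerN2 !lez_nat -geq_min -pfactor_dvdn ?absz_gt0 //.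
have dv (c : int) m : c != 0 -> (m <= logn p `|c|)%N -> ((p ^ m)%:Z %| c)%Z.
  by move=> c0 h; rewrite dvdzE /= pfactor_dvdn // absz_gt0.
have := dvdzE (p ^ minn (logn p `|a|) (logn p `|b|))%:Z (a + b).
move=> /= <-; apply: rpredD; apply: dv => //; first exact: geq_minl.
exact: geq_minr.
Qed.

Lemma padic_normD_lt x y e :
  padic_norm x < e -> padic_norm y < e -> padic_norm (x + y) < e.
Proof.
by move=> xe ye; apply: (le_lt_trans (padic_normD x y)); rewrite gt_max xe ye.
Qed.

End PadicNorm.

Section CauchySequences.
Variables (p : nat) (p_pr : prime p).
Local Notation "`| x |_p" := (padic_norm p x) (format "`| x |_p").

(* The primality proof is not used here: it is an argument so that the
   algebraic instances below, which need it, can be inferred. *)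
Definition padic_cauchy of prime p : pred (nat -> rat) := fun u =>
  `[< forall e : rat, 0 < e -> exists N, forall m n,
        (N <= m)%N -> (N <= n)%N -> `|u m - u n|_p < e >].

Lemma padic_cauchy_bounded u : padic_cauchy p_pr u ->
  exists B N, 0 < B /\ forall n, (N <= n)%N -> `|u n|_p < B.
Proof.
move=> /asboolP /(_ 1 ltr01) [N uN].
exists (Num.max 1 `|u N|_p + 1), N; split => [|n Nn].
  by rewrite addr_gt0 // lt_max ltr01.
rewrite -[u n](subrK (u N)) padic_normD_lt //.
  by rewrite (lt_le_trans (uN n N Nn (leqnn N))) // lerDr le_max ler01.
by rewrite ltr_pwDr // le_max lexx orbT.
Qed.

Lemma padic_cauchy_subring : subring_closed (padic_cauchy p_pr).
Proof.
split => [|u v /asboolP uC /asboolP vC|u v uC vC]; apply/asboolP => e e0.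
- by exists 0%N => m n _ _; rewrite subrr padic_norm0.
- have [[N uN] [M vM]] := (uC e e0, vC e e0).
  exists (maxn N M) => m n; rewrite !geq_max => /andP[Nm Mm] /andP[Nn Mn].
  rewrite [X in `|X|_p](_ : _ = (u m - u n) + (v n - v m)).
    by rewrite padic_normD_lt ?uN ?vM.
  by rewrite !fctE opprD opprK addrACA [v n - _]addrC.
- have [B [N1 [B0 uB]]] := padic_cauchy_bounded uC.
  have [D [M1 [D0 vD]]] := padic_cauchy_bounded vC.
  move: uC vC => /asboolP uC /asboolP vC.
  have [N2 uN] := uC (e / D) (divr_gt0 e0 D0).
  have [M2 vM] := vC (e / B) (divr_gt0 e0 B0).
  exists (maxn (maxn N1 M1) (maxn N2 M2)) => m n.
  rewrite !geq_max => /andP[/andP[a b] /andP[c d]] /andP[/andP[a' b'] /andP[c' d']].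
  rewrite [X in `|X|_p](_ : _ = u m * (v m - v n) + (u m - u n) * v n).
    rewrite padic_normD_lt // padic_normM //.
      by rewrite -(divfK (lt0r_neq0 B0) e) mulrC ltr_pM ?padic_norm_ge0 ?uB ?vM.
    by rewrite -(divfK (lt0r_neq0 D0) e) ltr_pM ?padic_norm_ge0 ?uN ?vD.
  by rewrite !fctE mulrBr mulrBl addrA subrK.
Qed.

HB.instance Definition _ :=
  GRing.isSubringClosed.Build (nat -> rat) (padic_cauchy p_pr)
    padic_cauchy_subring.

Record cauchy_seq := CauchySeq {
  cauchy_seq_val :> nat -> rat;
  _ : cauchy_seq_val \in padic_cauchy p_pr }.

HB.instance Definition _ := [isSub for cauchy_seq_val].
HB.instance Definition _ := [Choice of cauchy_seq by <:].
HB.instance Definition _ := [SubChoice_isSubComNzRing of cauchy_seq by <:].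

Definition padic_null : pred cauchy_seq := fun u =>
  `[< forall e : rat, 0 < e -> exists N, forall n, (N <= n)%N -> `|u n|_p < e >].

Lemma padic_null_ideal : idealr_closed padic_null.
Proof.
split => [||a u v /asboolP u0 /asboolP v0].
- by apply/asboolP => e e0; exists 0%N => n _; rewrite padic_norm0.
- apply/asboolP => /(_ 1 ltr01) [N /(_ N (leqnn N))].
  by rewrite padic_norm1 ltxx.
- apply/asboolP => e e0.
  have [B [N1 [B0 aB]]] := padic_cauchy_bounded (valP a).
  have [[N2 uN] [N3 vN]] := (u0 (e / B) (divr_gt0 e0 B0), v0 e e0).
  exists (maxn N1 (maxn N2 N3)) => n; rewrite !geq_max => /and3P[n1 n2 n3].
  rewrite padic_normD_lt ?vN // padic_normM //.
  by rewrite -(divfK (lt0r_neq0 B0) e) mulrC ltr_pM ?padic_norm_ge0 ?aB ?uN.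
Qed.

HB.instance Definition _ :=
  isIdealr.Build cauchy_seq padic_null padic_null_ideal.

Let null_ideal : idealr cauchy_seq := Idealr.clone _ padic_null _.

(* The field Q_p as the completion of Q: Cauchy sequences of rationals for the
   p-adic absolute value, modulo the sequences that converge to 0. *)
Definition padic := {ideal_quot null_ideal}.

HB.instance Definition _ := Choice.on padic.
HB.instance Definition _ := GRing.ComNzRing.on padic.
HB.instance Definition _ := EqQuotient.on padic.

Lemma padic_piP (u v : cauchy_seq) :
  \pi_padic u = \pi_padic v <-> padic_null (u - v).
Proof.
by split => [/eqP|h]; [|apply/eqP]; rewrite piE Quotient.equivE.
Qed.
End CauchySequences.

Section PadicField.
Variables (p : nat) (p_pr : prime p).
Local Notation "`| x |_p" := (padic_norm p x) (format "`| x |_p").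
Local Notation Qp := (padic p_pr).

Lemma padic_nullPn (u : cauchy_seq p_pr) : ~~ padic_null u ->
  exists2 e : rat, 0 < e & exists N, forall n, (N <= n)%N -> e <= `|u n|_p.
Proof.
move=> /asboolPn /existsNP[e /not_implyP[e0 /forallNP un]].
have /asboolP/(_ e e0)[N uN] := valP u.
exists e => //; exists N => n Nn; rewrite leNgt; apply/negP => une.
apply: (un N) => m Nm; rewrite -[u m](subrK (u n)).
by rewrite padic_normD_lt // uN.
Qed.

Lemma padic_cauchyV (u : cauchy_seq p_pr) : ~~ padic_null u ->
  padic_cauchy p_pr (fun n => (u n)^-1).
Proof.
move=> /padic_nullPn[d d0 [N1 ud]]; apply/asboolP => e e0.
have /asboolP/(_ (e * d * d))[|N2 uN] := valP u; first by rewrite !mulr_gt0.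
exists (maxn N1 N2) => m n; rewrite !geq_max => /andP[m1 m2] /andP[n1 n2].
have pos k : (N1 <= k)%N -> 0 < `|u k|_p.
  by move=> /ud; exact: lt_le_trans.
have neq k : (N1 <= k)%N -> u k != 0 by move=> /pos; rewrite padic_norm_gt0.
rewrite [X in `|X|_p](_ : _ = (u n - u m) * ((u m)^-1 * (u n)^-1)); last first.
  rewrite mulrBl [(u m)^-1 * _]mulrC mulrA mulfV ?neq // mul1r.
  by rewrite [(u n)^-1 * _]mulrC mulrA mulfV ?neq // mul1r.
rewrite !padic_normM // !padic_normV // -invfM ltr_pdivrMr ?mulr_gt0 ?pos //.
rewrite (lt_le_trans (uN n m n2 m2)) // -mulrA ler_pM2l //.
by rewrite ler_pM ?(ltW d0) ?ud.
Qed.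

Definition cauchy_inv (u : cauchy_seq p_pr) : cauchy_seq p_pr :=
  insubd 0 (fun n => (u n)^-1).

Definition padic_inv (x : Qp) : Qp :=
  if x == 0 then 0 else \pi_Qp (cauchy_inv (repr x)).

Lemma padic_mulVf (x : Qp) : x != 0 -> padic_inv x * x = 1.
Proof.
move=> x0; rewrite /padic_inv (negbTE x0) -{2}[x]reprK.
have : ~~ padic_null (repr x).
  apply: contra x0 => xn; rewrite -[x]reprK.
  have -> : 0 = \pi_Qp 0 by rewrite piE.
  by apply/eqP/padic_piP; rewrite subr0.
set u := repr x => un.
have -> : 1 = \pi_Qp 1 by rewrite piE.
rewrite -(rmorphM \pi_Qp); apply/padic_piP/asboolP => e e0.
have [d d0 [N ud]] := padic_nullPn un.
exists N => n /ud dn.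
rewrite /= /cauchy_inv insubdK; last exact: padic_cauchyV.
have u0 : u n != 0 by rewrite -(padic_norm_gt0 p_pr) (lt_le_trans d0).
by rewrite [X in `|X|_p](_ : _ = 0) ?padic_norm0 // !fctE mulVf // subrr.
Qed.

Lemma padic_invr0 : padic_inv 0 = 0.
Proof. by rewrite /padic_inv eqxx. Qed.

HB.instance Definition _ :=
  GRing.ComNzRing_isField.Build Qp padic_mulVf padic_invr0.
End PadicField.

Section PadicTopology.
Variables (p : nat) (p_pr : prime p).
Local Notation "`| x |_p" := (padic_norm p x) (format "`| x |_p").
Local Notation Qp := (padic p_pr).

(* The sequence |repr x n - repr y n|_p is either eventually constant or
   tends to 0, so this says that its limit, the distance of x and y, is < e. *)
Definition padic_ball (x : Qp) (e : rat) (y : Qp) : Prop :=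
  exists N, forall n, (N <= n)%N -> `|repr x n - repr y n|_p < e.

Lemma padic_ball_center x e : 0 < e -> padic_ball x e x.
Proof. by move=> e0; exists 0%N => n _; rewrite subrr padic_norm0. Qed.

Lemma padic_ball_sym x y e : padic_ball x e y -> padic_ball y e x.
Proof. by move=> [N xy]; exists N => n /xy; rewrite padic_normB. Qed.

Lemma padic_ball_max x y z e1 e2 :
  padic_ball x e1 y -> padic_ball y e2 z -> padic_ball x (Num.max e1 e2) z.
Proof.
move=> [N xy] [M yz]; exists (maxn N M) => n; rewrite geq_max => /andP[Nn Mn].
rewrite -[repr x n](subrK (repr y n)) -addrA.
by rewrite padic_normD_lt // lt_max ?xy ?yz ?orbT.
Qed.

Lemma padic_ball_triangle x y z e1 e2 :
  padic_ball x e1 y -> padic_ball y e2 z -> padic_ball x (e1 + e2) z.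
Proof.
move=> [N xy] [M yz]; exists (maxn N M) => n; rewrite geq_max => /andP[Nn Mn].
have e10 := le_lt_trans (padic_norm_ge0 p _) (xy n Nn).
have e20 := le_lt_trans (padic_norm_ge0 p _) (yz n Mn).
rewrite -[repr x n](subrK (repr y n)) -addrA.
rewrite padic_normD_lt // ?(lt_le_trans (xy n Nn)) ?(lt_le_trans (yz n Mn)) //.
  by rewrite lerDl ltW.
by rewrite lerDr ltW.
Qed.

HB.instance Definition _ := hasNbhs.Build Qp (nbhs_ (entourage_ padic_ball)).
HB.instance Definition _ := Nbhs_isPseudoMetric.Build rat Qp
  erefl padic_ball_center padic_ball_sym padic_ball_triangle erefl.

Lemma padic_ballE (u v : cauchy_seq p_pr) e :
  ball (\pi_Qp u) e (\pi_Qp v) <->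
  exists N, forall n, (N <= n)%N -> `|u n - v n|_p < e.
Proof.
have E (w : cauchy_seq p_pr) (d : rat) : 0 < d ->
    exists N, forall n, (N <= n)%N -> `|repr (\pi_Qp w) n - w n|_p < d.
  have /padic_piP/asboolP : \pi_Qp (repr (\pi_Qp w)) = \pi_Qp w by rewrite reprK.
  exact.
split => -[N h].
all: have e0 : 0 < e := le_lt_trans (padic_norm_ge0 p _) (h N (leqnn N)).
all: have [[M1 h1] [M2 h2]] := (E u e e0, E v e e0).
all: exists (maxn N (maxn M1 M2)) => n; rewrite !geq_max => /and3P[n0 n1 n2].
  rewrite [X in `|X|_p](_ : _ = (u n - repr (\pi_Qp u) n) +
    ((repr (\pi_Qp u) n - repr (\pi_Qp v) n) + (repr (\pi_Qp v) n - v n))).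
    apply: padic_normD_lt => //; first by rewrite padic_normB; exact: h1.
    by apply: padic_normD_lt => //; [exact: h|exact: h2].
  by rewrite !addrA !subrK.
rewrite [X in `|X|_p](_ : _ = (repr (\pi_Qp u) n - u n) +
  ((u n - v n) + (v n - repr (\pi_Qp v) n))).
  apply: padic_normD_lt => //; first exact: h1.
  by apply: padic_normD_lt => //; [exact: h|rewrite padic_normB; exact: h2].
by rewrite !addrA !subrK.
Qed.

Fact cauchy_const_subproof (r : rat) : padic_cauchy p_pr (fun=> r).
Proof. by apply/asboolP => e e0; exists 0%N => m n _ _; rewrite subrr padic_norm0. Qed.

Definition cauchy_const (r : rat) : cauchy_seq p_pr :=
  CauchySeq (cauchy_const_subproof r).

Definition padic_of_rat (r : rat) : Qp := \pi_Qp (cauchy_const r).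

Fact padic_of_rat_is_zmod : zmod_morphism padic_of_rat.
Proof.
move=> r s; rewrite /padic_of_rat -(rmorphB \pi_Qp); congr (\pi _).
exact: val_inj.
Qed.
Fact padic_of_rat_is_monoid : monoid_morphism padic_of_rat.
Proof.
split => [|r s]; rewrite /padic_of_rat.
  by rewrite -(rmorph1 \pi_Qp); congr (\pi _); exact: val_inj.
by rewrite -(rmorphM \pi_Qp); congr (\pi _); exact: val_inj.
Qed.
HB.instance Definition _ :=
  GRing.isZmodMorphism.Build rat Qp padic_of_rat padic_of_rat_is_zmod.
HB.instance Definition _ :=
  GRing.isMonoidMorphism.Build rat Qp padic_of_rat padic_of_rat_is_monoid.

Lemma ratr_padicE (r : rat) : ratr r = padic_of_rat r.
Proof. by rewrite -(fmorph_eq_rat padic_of_rat). Qed.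

Lemma padic_ball_ratr (r s : rat) e :
  ball (ratr r : Qp) e (ratr s) <-> `|r - s|_p < e.
Proof.
rewrite !ratr_padicE padic_ballE; split => [[N /(_ N (leqnn N))] //|rs].
by exists 0%N.
Qed.

Lemma padic_rat_approx (x : Qp) (e : rat) : 0 < e ->
  exists r : rat, ball x e (ratr r).
Proof.
move=> e0; rewrite -[x]reprK.
have /asboolP/(_ e e0)[N h] := valP (repr x).
exists (repr x N); rewrite ratr_padicE; apply/padic_ballE.
by exists N => n Nn; apply: h.
Qed.

Lemma padic_dense_rat : dense (range (ratr : rat -> Qp)).
Proof.
move=> O [x Ox] oO; have /nbhs_ballP[e e0 xO] : nbhs x O.
  exact: open_nbhs_nbhs.
have [r xr] := padic_rat_approx x e0.
by exists (ratr r); split; [exact: xO|exists r].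
Qed.

Lemma padic_complete (F : set_system Qp) :
  ProperFilter F -> cauchy F -> exists x : Qp, F --> x.
Proof.
move=> FF Fc; pose d k : rat := k.+1%:R^-1.
have d0 k : 0 < d k by rewrite invr_gt0 ltr0n.
have dle m n : (m <= n)%N -> d n <= d m.
  by move=> mn; rewrite lef_pV2 ?posrE ?ltr0n // ler_nat.
have arch (e : rat) : 0 < e -> exists k, d k < e.
  move=> e0; exists (Num.bound e^-1); rewrite invf_plt ?posrE ?ltr0n //.
  apply: (lt_trans (archi_boundP _)); first by rewrite invr_ge0 ltW.
  by rewrite ltr_nat.
have /choice[u uF] k : exists r : rat, F (ball (ratr r : Qp) (d k)).
  have [x xF] : exists x : Qp, F (ball x (d k)) by apply: (cauchyP F).1 (d0 k).
  have [r xr] := padic_rat_approx x (d0 k).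
  exists r; apply: filterS xF => y xy.
  by rewrite -[d k](maxxx); apply: padic_ball_max (ball_sym xr) xy.
have uu k n : (k <= n)%N -> `|u n - u k|_p < d k.
  move=> kn; apply/padic_ball_ratr.
  have [y [yk yn]] := filter_ex (filterI (uF k) (uF n)).
  rewrite -(max_r (dle _ _ kn)).
  exact: padic_ball_max yn (ball_sym yk).
have uC : padic_cauchy p_pr u.
  apply/asboolP => e /arch[k ke]; exists k => m n km kn.
  rewrite -[u m](subrK (u k)) -addrA padic_normD_lt //.
    exact: lt_trans (uu _ _ km) ke.
  by rewrite padic_normB; exact: lt_trans (uu _ _ kn) ke.
exists (\pi_Qp (CauchySeq uC)); apply/cvg_ballP => e /arch[k ke].
apply: filterS (uF k) => y uky.
rewrite -[e]maxxx; apply: (@padic_ball_max _ (ratr (u k))).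
  rewrite ratr_padicE; apply/padic_ballE; exists k => n kn /=.
  exact: lt_trans (uu _ _ kn) ke.
by apply: le_ball uky; exact: ltW.
Qed.
End PadicTopology.

Definition ratio_set (A : set nat) : set rat :=
  [set a%:R / b%:R | a in A & b in A].

(* Main.v *)
(** Suppose that no [R(A_i)] is dense in [Q_p] for each of [m] primes [p]; we
    show that [2 ^ m <= k].  For each [i] and [p] the set [R(A_i)] avoids a
    ball, which contains a coset [p ^ v * u * (1 + p ^ N * Z_p)] or the inverse
    of one with [0 <= v].  Cut out of the natural numbers a finite box whose
    points are recorded, for each [p], by the valuation (below a bound [L]) and
    the unit part modulo [p ^ N]; by the Chinese remainder theorem every
    combination occurs.  The image of [A_i] in the factor at [p] is disjoint
    from its translate by [(v, u)], and, [L] being a multiple of all the [2 v],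
    such an image fills at most half of the factor.  Hence each [A_i] covers at
    most [2 ^ - m] of the box, whereas the [k] sets cover all of it. *)

Require Import Defs.
From mathcomp Require Import all_boot all_order all_algebra.
From mathcomp Require Import all_classical.
From mathcomp Require Import topology.
From mathcomp Require cyclic.
From mathcomp Require Import zify.

Set Implicit Arguments.
Unset Strict Implicit.
Unset Printing Implicit Defensive.

(** * Counting in finite products *)

Lemma card_family_prod (I T : finType) (D : I -> {set T}) :
  #|family D| = \prod_j #|D j|.
Proof. by rewrite card_family foldrE big_map big_enum. Qed.

(** [C] and [f @: C] are disjoint subsets of [D] of equal size. *)
Lemma leq_card_disjoint_image (T : finType) (D C : {set T}) (f : T -> T) :
    C \subset D -> {in D &, injective f} -> {in D, forall x, f x \in D} ->
    {in C &, forall x y, f x != y} ->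
  2 * #|C| <= #|D|.
Proof.
move=> CD f_inj fD fC; have fCD : f @: C \subset D.
  by apply/fintype.subsetP => _ /imsetP[x xC ->]; apply/fD/(fintype.subsetP CD).
have dis : [disjoint C & f @: C].
  apply/fintype.pred0P => y; apply/negbTE/negP => /andP[yC /imsetP[x xC yx]].
  by move: (fC x y xC yC); rewrite yx eqxx.
rewrite mul2n -addnn -[X in _ + X](card_in_imset (f := f)); last first.
  by move=> x y /(fintype.subsetP CD) xD /(fintype.subsetP CD); apply: f_inj.
have /eqP <- : #|C :|: f @: C| == #|C| + #|f @: C| by rewrite (leq_card_setU _ _).2.
by rewrite subset_leq_card // finset.subUset CD.
Qed.

(* The [j]-th projection of a colour class is disjoint from a translate of
   itself, so it fills at most half of [D j]; hence the class fills at most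
   a fraction [2 ^ - #|I|] of the box. *)
Lemma leq_exp2_colours (I T : finType) (k : nat) (D : I -> {set T})
    (c : {ffun I -> T} -> 'I_k) (f : 'I_k -> I -> T -> T) :
    (forall j, 0 < #|D j|) ->
    (forall i j, {in D j &, injective (f i j)}) ->
    (forall i j, {in D j, forall x, f i j x \in D j}) ->
    (forall j, {in family D &, forall g h, c g = c h -> f (c g) j (g j) != h j}) ->
  2 ^ #|I| <= k.
Proof.
move=> D0 f_inj fD fc.
have prod_gt0 : 0 < \prod_j #|D j| by exact: prodn_gt0.
(* Scaling by the size of the box reduces the claim to one bound for each of the [k] colour classes,
   which are then summed. *)
rewrite -(leq_pmul2r prod_gt0) -{1}card_family_prod.
have -> : #|family D| = \sum_(i < k) #|[set g in family D | c g == i]|.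
  rewrite -sum1_card (partition_big c xpredT) //=; apply: eq_bigr => i _.
  by rewrite -sum1_card; apply: eq_bigl => g; rewrite inE.
rewrite -[k in leqRHS]card_ord -sum_nat_const big_distrr /=; apply: leq_sum => i _.
pose C j : {set T} := [set (g : {ffun I -> T}) j | g in [set g in family D | c g == i]].
have CP j x : reflect (exists g, [/\ g \in family D, c g = i & x = g j]) (x \in C j).
  apply: (iffP imsetP) => [[g]|[g [gD gi ->]]].
    by rewrite inE => /andP[gD /eqP gi] ->; exists g.
  by exists g => //; rewrite inE gD gi eqxx.
(* A class lies in the product of its projections [C j], and each factor 2 is then absorbed by one
   coordinate. *)
apply: (@leq_trans (2 ^ #|I| * \prod_j #|C j|)).
  rewrite leq_mul2l -card_family_prod; apply/orP; right; apply: subset_leq_card.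
  apply/fintype.subsetP => g; rewrite inE => /andP[gD /eqP gi].
  by apply/familyP => j; apply/CP; exists g.
rewrite -prod_nat_const -big_split /=; apply: leq_prod => j _.
apply: (@leq_card_disjoint_image _ _ _ (f i j)) => //.
  apply/fintype.subsetP => _ /CP[g [gD _ ->]]; exact: (familyP gD).
move=> _ _ /CP[g [gD gi ->]] /CP[h [hD hi ->]].
by rewrite -gi fc // gi.
Qed.

(** * Simultaneous congruences *)

Lemma chinese_remainder_seq (I : eqType) (s : seq I) (m r : I -> nat) :
    uniq s -> (forall i, i \in s -> 0 < m i) ->
    {in s &, forall i j, i != j -> coprime (m i) (m j)} ->
  exists2 n, 0 < n & {in s, forall i, n = r i %[mod m i]}.
Proof.
elim: s => [|i s IHs] /=; first by exists 1.
move=> /andP[si us] m0 co.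
have [||n n0 nr] := IHs us.
- by move=> j js; apply: m0; rewrite inE js orbT.
- by move=> j l js ls; apply: co; rewrite inE ?js ?ls orbT.
pose M := \prod_(j <- s) m j.
have iM : coprime (m i) M.
  rewrite /M big_seq; elim/big_ind: _ => [|a b|j js]; first exact: coprimen1.
    by rewrite coprimeMr => ->.
  by apply: co; rewrite ?mem_head ?inE ?js ?orbT //; apply: contraNneq si => ->.
(* The term [m i * M] changes no residue and makes the solution positive. *)
exists (chinese (m i) M (r i) n + m i * M).
  rewrite addn_gt0 muln_gt0 m0 ?mem_head //= orbC.
  rewrite /M big_seq prodn_cond_gt0 // => j js.
  by rewrite m0 // inE js orbT.
move=> j; rewrite inE => /predU1P[->|js].
  by rewrite addnC mulnC modnMDl chinese_modl.
have jM : m j %| M by rewrite /M (big_rem j) //= dvdn_mulr.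
rewrite addnC -nr // -(modn_dvdm _ jM) modnMDl -(modn_dvdm n jM).
by rewrite chinese_modr.
Qed.

(** * Approximation by fractions in the [p]-adic norm *)

Section PadicApprox.
Import Order.TTheory GRing.Theory Num.Theory.
Local Open Scope ring_scope.

Lemma padic_norm_int (p : nat) (z : int) : z != 0 ->
  padic_norm p z%:~R = p%:R ^- logn p `|z|.
Proof.
move=> z0; rewrite /padic_norm intr_eq0 (negbTE z0) /padic_val.
by rewrite numq_int denq_int logn1 subr0 exprnN.
Qed.

Lemma padic_norm_dvd (p m : nat) (z : int) : prime p -> ((p ^ m)%:Z %| z)%Z ->
  padic_norm p z%:~R <= p%:R ^- m.
Proof.
move=> p_pr pz; have p_gt0 : 0 < p%:R :> rat by rewrite ltr0n prime_gt0.
have [->|z0] := eqVneq z 0; first by rewrite padic_norm0 invr_ge0 exprn_ge0 ?ltW.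
rewrite padic_norm_int // lef_pV2 ?posrE ?exprn_gt0 // ler_eXn2l ?ltr1n ?prime_gt1 //.
by rewrite -pfactor_dvdn ?absz_gt0.
Qed.

(** The difference is [(a * d - b * c) / (b * d)], whose numerator is divisible by [p ^ M]. *)
Lemma padic_norm_fracB (p M a b c d : nat) : prime p -> (0 < b)%N -> (0 < d)%N ->
    a * d = b * c %[mod p ^ M] ->
  padic_norm p (a%:R / b%:R - c%:R / d%:R)
    <= p%:R ^+ (logn p b + logn p d) / p%:R ^+ M.
Proof.
move=> p_pr b0 d0 abcd.
have bQ : b%:R != 0 :> rat by rewrite pnatr_eq0 -lt0n.
have dQ : d%:R != 0 :> rat by rewrite pnatr_eq0 -lt0n.
have -> : a%:R / b%:R - c%:R / d%:R =
    ((a * d)%N%:Z - (b * c)%N%:Z)%:~R / (b * d)%N%:Z%:~R :> rat.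
  rewrite rmorphB /= -!pmulrn !natrM mulrBl -!mulf_div.
  by rewrite !divff // mulr1 mul1r.
rewrite padic_normM // padic_normV // (@padic_norm_int _ (b * d)%N); last first.
  by rewrite eqz_nat -lt0n muln_gt0 b0.
rewrite invrK mulrC lognM //; apply: ler_wpM2l; first by rewrite exprn_ge0.
apply: padic_norm_dvd => //.
by rewrite -eqz_mod_dvd !modz_nat abcd.
Qed.

Lemma small_inv_exp (p : nat) (e : rat) : (1 < p)%N -> 0 < e ->
  exists n, p%:R ^- n < e.
Proof.
move=> p1 e0; exists (Num.bound e^-1).
rewrite invf_plt ?posrE // ?exprn_gt0 ?ltr0n ?(ltnW p1) //.
apply: (lt_trans (archi_boundP _)); first by rewrite invr_ge0 ltW.
by rewrite -natrX ltr_nat ltn_expl.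
Qed.

Lemma exp_ratio_le (p m n k : nat) : (0 < p)%N -> (m + k <= n)%N ->
  p%:R ^+ m / p%:R ^+ n <= p%:R ^- k :> rat.
Proof.
move=> p0 mkn; rewrite ler_pdivrMr ?exprn_gt0 ?ltr0n //.
rewrite mulrC ler_pdivlMr ?exprn_gt0 ?ltr0n // -exprD.
by rewrite ler_weXn2l ?ler1n.
Qed.

(** In an ultrametric space every point of a ball is a centre of it, so a ball missed by the ratios
    can be recentred, with the same radius, at a positive rational [c / d]. *)
Lemma not_dense_ratio_set (p : nat) (p_pr : prime p) (A : set nat) :
    ~ dense ([set ratr r | r in ratio_set A] : set (padic p_pr)) ->
  exists c d, exists2 e : rat, [/\ (0 < c)%N, (0 < d)%N & 0 < e] &
    forall a b, A a -> A b -> e <= padic_norm p (a%:R / b%:R - c%:R / d%:R).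
Proof.
move=> /existsNP[O /not_implyP[[x Ox] /not_implyP[oO OA]]].
have /nbhs_ballP[e e0 xO] : nbhs x O by exact: open_nbhs_nbhs.
have [r xr] := padic_rat_approx x e0.
have p1 := prime_gt1 p_pr.
have [n pn] := small_inv_exp p1 e0.
(* The added power of [p] is so large that [r'] is both positive and close to [r]. *)
pose r' := r + (p ^ (n + Num.bound `|r|))%:R.
have r'0 : 0 < r'.
  rewrite -ltrBlDl sub0r (le_lt_trans (ler_norm _)) // normrN.
  apply: (lt_le_trans (archi_boundP _)) => //; rewrite ler_nat.
  rewrite expnD; apply: leq_trans (ltnW (ltn_expl _ p1)) _.
  by rewrite leq_pmull // expn_gt0 ltnW.
have xr' : ball x e (ratr r').
  rewrite -[e]maxxx; apply: (padic_ball_max xr); apply/padic_ball_ratr.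
  rewrite opprD addNKr padic_normN.
  apply: le_lt_trans pn; apply: (padic_norm_dvd (z := (p ^ _)%N)) => //.
  by rewrite dvdzE /= dvdn_exp2l // leq_addr.
have Er : r' = `|numq r'|%N%:R / `|denq r'|%N%:R.
  by rewrite !natr_absz !gtr0_norm ?denq_gt0 ?numq_gt0 // divq_num_den.
exists `|numq r'|%N, `|denq r'|%N, e.
  by rewrite !absz_gt0 denq_neq0 numq_eq0 gt_eqF.
move=> a b Aa Ab; rewrite leNgt -Er; apply/negP => abr.
apply: OA; exists (ratr (a%:R / b%:R)); split; last first.
  by exists (a%:R / b%:R) => //; exists a => //; exists b.
apply: xO; rewrite -[e]maxxx; apply: (padic_ball_max xr'); apply/padic_ball_ratr.
by rewrite padic_normB.
Qed.
End PadicApprox.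

(** * From non-density to a forbidden coset *)

Definition modn_inv u q := u ^ (totient q).-1.

Lemma modn_invP u q : 0 < q -> coprime u q -> u * modn_inv u q = 1 %[mod q].
Proof.
by move=> q0 uq; rewrite -expnS prednK ?totient_gt0 // cyclic.Euler_exp_totient.
Qed.

Lemma coprime_modn_inv u q : coprime u q -> coprime (modn_inv u q) q.
Proof. exact: coprimeXl. Qed.

Lemma modn_mul_invK q a b c d : 0 < q -> coprime d q ->
  a = b * (c * modn_inv d q) %[mod q] -> a * d = b * c %[mod q].
Proof.
move=> q0 dq E; rewrite -modnMml E modnMml -!mulnA (mulnC _ d) -(modnMmr b) -(modnMmr c).
by rewrite modn_invP // modnMmr mulnA modnMmr muln1.
Qed.

(* No ratio of elements of [A] lies in the coset [p ^ v * u * (1 + p ^ M * Z_p)]. *)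
Definition separated p (A : set nat) v u M :=
  forall y a b, coprime a p -> coprime b p -> A (p ^ y * b) ->
    A (p ^ (y + v) * a) -> a <> b * u %[mod p ^ M].

Lemma separated_leq p A v u N M : N <= M ->
  separated p A v u N -> separated p A v u M.
Proof.
move=> NM sep y a b ap bp Ab Aa E; apply: (sep y a b) => //.
by rewrite -(modn_dvdm a (dvdn_exp2l p NM)) E modn_dvdm // dvdn_exp2l.
Qed.

(** With [al] and [be] the valuations of [c] and [d], the coset is that of [c / d] if [be <= al].
    Otherwise it is that of [d / c], with the two elements of [A] exchanged, which keeps [v] a
    natural number. *)
Lemma not_dense_separated p (p_pr : prime p) (A : set nat) :
    ~ dense ([set ratr r | r in ratio_set A] : set (padic p_pr)) ->
  exists v u N, coprime u p /\ separated p A v u N.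
Proof.
move=> /not_dense_ratio_set[c [d [e [c0 d0 e0] Ae]]].
have p1 := prime_gt1 p_pr; have p0 := ltnW p1.
have [c' pc cE] := pfactor_coprime p_pr c0.
have [d' pd dE] := pfactor_coprime p_pr d0.
have [n pn] := small_inv_exp p1 e0.
move Eal: (logn p c) cE => al cE; move Ebe: (logn p d) dE => be dE.
(* In [H] below the distance to [c / d] is at most [p ^ (be - al - N)], hence at most [p ^ - n < e].
   The successor makes [N] positive, so that coprimality to [p ^ N] and to [p] agree. *)
pose N := (n + be).+1.
have coN x : coprime x (p ^ N) = coprime x p by rewrite coprime_pexpr.
have pN0 : 0 < p ^ N by rewrite expn_gt0 p0.
have H x x' a b : x + be = x' + al -> coprime a p -> coprime b p ->
    A (p ^ x * a) -> A (p ^ x' * b) -> a * d' <> b * c' %[mod p ^ N].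
  move=> xx' ap bp Aa Ab E.
  have b0 : 0 < b by case: b bp {Ab E} => //; rewrite /coprime gcd0n (gtn_eqF p1).
  have M : p ^ x * a * d = p ^ x' * b * c %[mod p ^ (x + be + N)].
    have -> : p ^ x * a * d = p ^ (x + be) * (a * d').
      by rewrite dE (mulnC d') expnD mulnACA.
    have -> : p ^ x' * b * c = p ^ (x + be) * (b * c').
      by rewrite cE (mulnC c') xx' expnD mulnACA.
    by rewrite [p ^ (_ + N)]expnD -!muln_modr E.
  have := padic_norm_fracB p_pr _ d0 M; rewrite muln_gt0 expn_gt0 p0 b0 => /(_ isT).
  move=> /(Order.POrderTheory.le_trans (Ae _ _ Aa Ab)).
  move=> /(Order.POrderTheory.lt_le_trans pn); apply/negP.
  rewrite -Order.TotalTheory.leNgt exp_ratio_le //.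
  rewrite lognM ?expn_gt0 ?p0 // pfactorK // logn_coprime 1?coprime_sym // Ebe.
  by rewrite /N; lia.
have [le_ba|/ltnW le_ab] := leqP be al.
  exists (al - be), (c' * modn_inv d' (p ^ N)), N; split.
    by rewrite coprimeMl coprime_sym pc -coN coprime_modn_inv // coN coprime_sym.
  move=> y a b ap bp Ab Aa /modn_mul_invK; rewrite coN coprime_sym => /(_ pN0 pd).
  by apply: (H (y + (al - be)) y a b) => //; rewrite -addnA subnK.
exists (be - al), (d' * modn_inv c' (p ^ N)), N; split.
  by rewrite coprimeMl coprime_sym pd -coN coprime_modn_inv // coN coprime_sym.
move=> y a b ap bp Ab Aa /modn_mul_invK; rewrite coN coprime_sym => /(_ pN0 pc) /esym.
by apply: (H y (y + (be - al)) b a) => //; rewrite -addnA subnK.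
Qed.

(** * Pairing off valuations and units *)

(* Exchanges the even and odd blocks of length [v] of the valuation axis while
   multiplying by [u] or by its inverse [w].  As [_ %/ 0 = 0] is even, for
   [v = 0] it is multiplication by [u]. *)
Definition shift v u w q (z : nat * nat) :=
  if odd (z.1 %/ v) then (z.1 - v, z.2 * w %% q) else (z.1 + v, z.2 * u %% q).

(** For [0 < v] the map is an involution, as odd blocks return with the inverse factor [w]. For
    [v = 0] it is undone by multiplication by [w]. *)
Lemma shift_inj v u w q : u * w = 1 %[mod q] ->
  {in [pred z | z.2 < q] &, injective (shift v u w q)}.
Proof.
move=> uw; have ux x : x < q -> x * u %% q * w %% q = x.
  by move=> xq; rewrite modnMml -mulnA -modnMmr uw modnMmr muln1 modn_small.
have wx x : x < q -> x * w %% q * u %% q = x.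
  by move=> xq; rewrite modnMml -mulnA (mulnC w) -modnMmr uw modnMmr muln1 modn_small.
apply: (@can_in_inj _ _ _ _ (if v == 0 then shift v w u q else shift v u w q)).
move=> [y x] /= xq; case: posnP => [->|v0].
  by rewrite /shift !divn0 /= !addn0 ux.
rewrite /shift /=; case: (boolP (odd (y %/ v))) => odd_y; last first.
  by rewrite /= divnDr // divnn v0 addn1 /= odd_y /= addnK ux.
have vy : v <= y by rewrite leqNgt; apply: contraL odd_y => yv; rewrite divn_small.
move: odd_y; rewrite -{1}(subnK vy) divnDr // divnn v0 addn1 /= => /negbTE -> /=.
by rewrite subnK // wx.
Qed.

(** An even number of blocks of length [v] fills the range below [L], so the last one has an odd
    index and no even block is moved out. *)
Lemma shift_lt v u w q L z : (0 < v -> 2 * v %| L) -> z.1 < L -> (shift v u w q z).1 < L.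
Proof.
rewrite /shift; case: (posnP v) => [-> _|v0 /(_ isT)/dvdnP[c ->]]; first by rewrite divn0 addn0.
rewrite mulnA => zL; case: ifP => /= odd_z; first exact: leq_ltn_trans (leq_subr _ _) zL.
rewrite -ltn_divLR // divnDr // divnn v0 addn1 ltn_neqAle ltn_divLR // zL andbT.
by apply: contraFneq odd_z => /(congr1 odd); rewrite /= oddM andbF => /negbFE.
Qed.

Lemma shift_unit v u w q z : coprime u q -> coprime w q -> coprime z.2 q ->
  coprime (shift v u w q z).2 q.
Proof.
by move=> uq wq zq; rewrite /shift; case: ifP => _ /=; rewrite coprime_modl coprimeMl zq.
Qed.

Lemma shift_mod_lt v u w q z : 0 < q -> (shift v u w q z).2 < q.
Proof. by move=> q0; rewrite /shift; case: ifP => _ /=; rewrite ltn_mod. Qed.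

(** * Integers with prescribed valuations and unit parts *)

Lemma eqmod_expM p y N x n : 0 < p -> n = p ^ y * x %[mod p ^ (y + N)] ->
  exists2 z, n = p ^ y * z & z = x %[mod p ^ N].
Proof.
move=> p0 E; have py0 : 0 < p ^ y by rewrite expn_gt0 p0.
have /dvdnP[z nz] : p ^ y %| n.
  have pyN : p ^ y %| p ^ (y + N) by rewrite dvdn_exp2l // leq_addr.
  by rewrite /dvdn -(modn_dvdm n pyN) E modn_dvdm // modnMr.
exists z; first by rewrite mulnC.
move: E; rewrite nz (mulnC z) expnD -!muln_modr => /eqP.
by rewrite eqn_pmul2l // => /eqP.
Qed.

(** Each point of the box is coloured by a set containing an integer that realises it. If [f]
    matched two points of one colour at [j], their integers would have a ratio in the coset
    forbidden at [P j]. *)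
Lemma leq_exp2_separated k (I : finType) (P : I -> nat) (A : 'I_k -> set nat)
    (v u : 'I_k -> I -> nat) (N : nat) :
    (forall n, 0 < n -> exists i, A i n) ->
    injective P -> (forall j, prime (P j)) -> 0 < N ->
    (forall i j, coprime (u i j) (P j)) ->
    (forall i j, separated (P j) (A i) (v i j) (u i j) N) ->
  2 ^ #|I| <= k.
Proof.
move=> Acov P_inj P_pr N0 uP sep.
have P0 j : 0 < P j by exact: prime_gt0.
pose q j := P j ^ N; pose w i j := modn_inv (u i j) (q j).
have q0 j : 0 < q j by rewrite expn_gt0 P0.
have co_q x j : coprime x (q j) = coprime x (P j) by rewrite coprime_pexpr.
have uw i j : u i j * w i j = 1 %[mod q j] by apply: modn_invP; rewrite ?co_q.
(* [L] is a multiple of [2 * v i j] for every positive [v i j]; leaving out the zero values keeps it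
   positive. *)
pose L := 2 * \prod_(z : 'I_k * I | 0 < v z.1 z.2) v z.1 z.2.
have L0 : 0 < L by rewrite muln_gt0 prodn_cond_gt0.
pose W := \max_j q j; have qW j : q j <= W by exact: leq_bigmax.
(* All factors are cut out of one finite type, so [W] bounds every modulus [q j]. *)
pose val2 (z : 'I_L.+1 * 'I_W.+1) : nat * nat := (val z.1, val z.2).
have val2_inj : injective val2.
  by move=> [y x] [y' x'] [/val_inj -> /val_inj ->].
pose inord2 (z : nat * nat) : 'I_L.+1 * 'I_W.+1 := (inord z.1, inord z.2).
pose D j := [set z | [&& (val2 z).1 < L, (val2 z).2 < q j & coprime (val2 z).2 (q j)]]%SET.
pose f i j z := inord2 (shift (v i j) (u i j) (w i j) (q j) (val2 z)).
have DP j z : reflect [/\ (val2 z).1 < L, (val2 z).2 < q j & coprime (val2 z).2 (q j)]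
    (z \in D j) by rewrite inE; apply: and3P.
have fD i j z : z \in D j -> let z' := shift (v i j) (u i j) (w i j) (q j) (val2 z) in
    [&& z'.1 < L, z'.2 < q j & coprime z'.2 (q j)].
  move=> /DP[zL zq zco] /=; rewrite shift_lt ?shift_mod_lt ?shift_unit //.
  - by rewrite co_q.
  - by rewrite coprime_modn_inv // co_q.
  by move=> v0; rewrite dvdn_pmul2l // (bigD1 (i, j)) //= dvdn_mulr.
have fE i j z : z \in D j ->
  val2 (f i j z) = shift (v i j) (u i j) (w i j) (q j) (val2 z).
  move=> zD; have := fD i j z zD; rewrite /f.
  case: shift => y x /and3P[/= yL xq _]; rewrite /inord2 /val2 /=.
  congr (_, _); apply: inordK; rewrite ltnS; first exact: ltnW.
  exact: leq_trans (ltnW xq) (qW j).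
(* For [g] in the box, the modulus [P j ^ (y + N)] fixes both the valuation [y] at [P j] and the
   unit part modulo [P j ^ N]. *)
pose near (g : {ffun I -> 'I_L.+1 * 'I_W.+1}) (t : 'I_k * nat) := A t.1 t.2 /\
  forall j, t.2 = P j ^ (val2 (g j)).1 * (val2 (g j)).2
              %[mod P j ^ ((val2 (g j)).1 + N)].
have /choice[t tP] g : exists t, near g t.
  have [||n n0 nP] := @chinese_remainder_seq I (enum I)
      (fun j => P j ^ ((val2 (g j)).1 + N))
      (fun j => P j ^ (val2 (g j)).1 * (val2 (g j)).2) (enum_uniq I).
  - by move=> j _; rewrite expn_gt0 P0.
  - move=> j l _ _ jl; rewrite coprimeXl // coprimeXr //.
    rewrite prime_coprime // dvdn_prime2 //.
    by apply: contraNneq jl => /P_inj ->.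
  have [i Ain] := Acov n n0.
  by exists (i, n); split=> // j; apply: nP; rewrite mem_enum.
apply: (leq_exp2_colours (D := D) (c := fun g => (t g).1) (f := f)).
- move=> j; apply/card_gt0P; exists (inord2 (0, 1 %% q j)).
  have q1 : 1 < q j by rewrite -(expn0 (P j)) ltn_exp2l ?prime_gt1.
  rewrite inE /inord2 /= !inordK // modn_small ?L0 ?q1 ?coprime1n //.
  by rewrite ltnS (leq_trans (ltnW q1)).
- move=> i j z z' zD z'D /(congr1 val2); rewrite !fE // => /(shift_inj (uw i j)) E.
  by apply/val2_inj/E; rewrite inE; [case/DP: zD | case/DP: z'D].
- by move=> i j z zD; apply/DP; rewrite fE //; apply/and3P/fD.
move=> j g h gD hD gh; apply/eqP => /(congr1 val2); rewrite fE ?(familyP gD) //.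
have [Ag /(_ j)/(eqmod_expM (P0 j))[a ta ax]] := tP g.
have [Ah /(_ j)/(eqmod_expM (P0 j))[b tb bx]] := tP h.
have /DP[_ _ xg] := familyP gD j; have /DP[_ _ xh] := familyP hD j.
have ap : coprime a (P j) by rewrite -co_q -coprime_modl ax coprime_modl.
have bp : coprime b (P j) by rewrite -co_q -coprime_modl bx coprime_modl.
move: ta tb ax bx Ag Ah; rewrite -gh; move: (t g).1 => i -> ->.
case: (val2 (g j)) (val2 (h j)) => [y x] [y' x'] /= ax bx Ag Ah.
(* In an odd block the integer of [g] has the larger valuation and [a] is the numerator; in an even
   block it is that of [h], and [b] is. An odd quotient is nonzero, so [y - v i j] is not
   truncated. *)
rewrite /shift /=; case: ifP => odd_y [Ey Ex].
  have vy : v i j <= y by rewrite leqNgt; apply: contraL odd_y => yv; rewrite divn_small.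
  apply: (sep i j y' a b) => //; first by rewrite -Ey subnK.
  rewrite ax -modnMml bx -Ex modn_mod modnMml -mulnA (mulnC (w i j)).
  by rewrite -modnMmr uw modnMmr muln1.
apply: (sep i j y b a) => //; first by rewrite Ey.
by rewrite bx -Ex modn_mod -[in RHS]modnMml ax modnMml.
Qed.

(** * Bounding the exceptional primes *)

Local Open Scope classical_set_scope.

Theorem theorem3p1 (k : nat) (k_gt0 : (0 < k)%N) (A : 'I_k -> set nat)
    (partA : classical_sets.partition [set: 'I_k] A [set n : nat | (0 < n)%N]) :
  exists2 s : seq nat, (size s <= trunc_log 2 k)%N &
    forall (p : nat) (p_pr : prime p), p \notin s ->
      exists i : 'I_k,
        dense ([set ratr r | r in ratio_set (A i)] : set (padic p_pr)).
Proof.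
have [Acov _ _] := partA.
have cov n : 0 < n -> exists i, A i n.
  move=> n0; have : [set n : nat | 0 < n] n by [].
  by rewrite -Acov => -[i _ Ain]; exists i.
pose bad p := exists p_pr : prime p, forall i,
  ~ dense ([set ratr r | r in ratio_set (A i)] : set (padic p_pr)).
have size_bad s : uniq s -> (forall p, p \in s -> bad p) -> size s <= trunc_log 2 k.
  move=> us bad_s; apply: trunc_log_max => //.
  pose P (j : 'I_(size s)) := nth 0 s j.
  have badP j : bad (P j) by apply/bad_s/mem_nth.
  have P_pr j : prime (P j) by case: (badP j).
  have /choice[t tP] (ij : 'I_k * 'I_(size s)) : exists t : nat * nat * nat,
      coprime t.1.2 (P ij.2) /\ separated (P ij.2) (A ij.1) t.1.1 t.1.2 t.2.
    have [p_pr /(_ ij.1)/not_dense_separated[v [u [N uN]]]] := badP ij.2.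
    by exists (v, u, N).
  rewrite -[X in 2 ^ X]card_ord.
  (* Separation persists for larger exponents, so the maximum serves all sets and primes at once;
     its successor is positive. *)
  apply: (@leq_exp2_separated k _ P A (fun i j => (t (i, j)).1.1)
    (fun i j => (t (i, j)).1.2) (\max_ij (t ij).2).+1) => //.
  - by move=> i j /eqP; rewrite nth_uniq // => /eqP/val_inj.
  - by move=> i j; case: (tP (i, j)).
  move=> i j; have [_] := tP (i, j); apply: separated_leq.
  by rewrite leqW // (leq_bigmax (i, j)).
(* The bound on lengths yields a longest duplicate-free list of bad primes; it contains them all,
   since a missing one would extend it. *)
pose Q m := `[< exists s, [/\ uniq s, size s = m & forall p, p \in s -> bad p] >].
have Q0 : exists m, Q m by exists 0; apply/asboolP; exists [::].
have Q_le m : Q m -> m <= trunc_log 2 k by move=> /asboolP[s [us <- /size_bad->]].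
have [_ /asboolP[s [us <- bad_s]] max_s] := ex_maxnP Q0 Q_le.
exists s => [|p p_pr ps]; first exact: size_bad.
apply: contrapT => /forallNP nd.
have /max_s : Q (size (p :: s)) by apply/asboolP; exists (p :: s); split=> //=;
  [rewrite ps | move=> l; rewrite inE => /predU1P[->|/bad_s//]; exists p_pr].
by rewrite ltnn.
Qed.
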